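(* Let $A\in\mathbb{S}\subset\mathbb{K}^{n\times n}$. Suppose $\mathcal{X}_c$ is an invariant subspace of $A$ of dimension $p\le n$ with $AX_c=X_c\Lambda_c$, where $X_c\in\mathbb{K}^{n\times p}$ is a full rank matrix with $\mathfrak{R}(X_c)=\mathcal{X}_c$ and $\Lambda_c\in\mathbb{K}^{p\times p}$. Then $\mathcal{X}_c$ remains an invariant subspace of $A+\Delta A$ for some $\Delta A\in\mathbb{S}$ if and only if there exists a matrix $\Lambda_a\in\mathbb{K}^{p\times p}$ such that $$R^\star(X_c^\star HX_c)R\Lambda_a=\epsilon_2\Lambda_a^\star R^\star(X_c^\star HX_c)R$$ for some nonsingular matrix $R\in\mathbb{K}^{p\times p}$. If such a matrix $\Lambda_a$ (with such an $R$) exists, then the matrices $\Delta A\in\mathbb{S}$ such that $(A+\Delta A)(X_cR)=(X_cR)\Lambda_a$ are exactly those of the form $$\Delta A=X_c\widetilde{R}(X_cR)^\dagger+\epsilon_1\epsilon_2H^{-1}\left[\left(HX_c\widetilde{R}(X_cR)^\dagger\right)^\star-\left((X_cR)^\dagger\right)^\star\left(R^\star X_c^\star HX_c\widetilde{R}\right)^\star(X_cR)^\dagger\right]+H^{-1}\left(I-(X_cR)(X_cR)^\dagger\right)^\star Z\left(I-(X_cR)(X_cR)^\dagger\right),$$ where $\widetilde{R}=R\Lambda_a-\Lambda_cR$ and $Z\in\mathbb{K}^{n\times n}$ satisfies $Z^\star=\epsilon_1\epsilon_2Z$.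
   Context: $\mathbb{K}\in\{\mathbb{R},\mathbb{C}\}$ and $\star\in\{T,*\}$ (transpose or conjugate transpose). $H\in\mathbb{K}^{n\times n}$ is a fixed unitary matrix with $H^\star=\epsilon_1H$, $\epsilon_1\in\{1,-1\}$. For $A\in\mathbb{K}^{n\times n}$ put $A^{[\star]}=H^{-1}A^\star H$. Let $\mathbb{L}=\{A\in\mathbb{K}^{n\times n}:A^{[\star]}=-A\}$ (Lie algebra) and $\mathbb{J}=\{A\in\mathbb{K}^{n\times n}:A^{[\star]}=A\}$ (Jordan algebra). $\mathbb{S}\in\{\mathbb{L},\mathbb{J}\}$, with $\epsilon_2=1$ if $\mathbb{S}=\mathbb{J}$ and $\epsilon_2=-1$ if $\mathbb{S}=\mathbb{L}$. $X^\dagger$ is the Moore-Penrose pseudoinverse, $\mathfrak{R}(X)$ is the column space of $X$, and $I$ is the identity of order $n$. *)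

(* Defs.v *)
From HB Require Import structures.
From mathcomp Require Import all_boot all_order all_algebra.
From mathcomp Require Import complex.
From mathcomp Require Import reals.
Set Implicit Arguments.
Unset Strict Implicit.
Unset Printing Implicit Defensive.
Import Order.TTheory GRing.Theory Num.Theory.
Local Open Scope ring_scope.

Inductive field_kind := RealField | ComplexField.

Definition base_field (R : realType) (k : field_kind) : numFieldType :=
  match k with
  | RealField => R
  | ComplexField => R[i]
  end.

Definition conj_base (R : realType) (k : field_kind) :
    base_field R k -> base_field R k :=
  match k with
  | RealField => fun x : R => x
  | ComplexField => fun z : R[i] => Num.conj z
  end.

Definition conj_tr (R : realType) (k : field_kind) (m n : nat)
    (A : 'M[base_field R k]_(m, n)) : 'M[base_field R k]_(n, m) :=
  map_mx (@conj_base R k) A^T.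

Inductive star_kind := Transpose | ConjTranspose.

Definition star (R : realType) (k : field_kind) (s : star_kind) (m n : nat)
    (A : 'M[base_field R k]_(m, n)) : 'M[base_field R k]_(n, m) :=
  match s with
  | Transpose => A^T
  | ConjTranspose => conj_tr A
  end.

(* Unitarity and the Moore-Penrose inverse always refer to the conjugate
   transpose, also when the star operation is the plain transpose over the
   complex numbers. *)
Definition unitary_matrix (R : realType) (k : field_kind) (n : nat)
    (H : 'M[base_field R k]_n) : Prop :=
  conj_tr H *m H = 1%:M.

Definition penrose (R : realType) (k : field_kind) (m n : nat)
    (X : 'M[base_field R k]_(m, n)) (Y : 'M[base_field R k]_(n, m)) : bool :=
  [&& X *m Y *m X == X, Y *m X *m Y == Y,
      conj_tr (X *m Y) == X *m Y & conj_tr (Y *m X) == Y *m X].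

Section MoorePenrose.
Variables (R : realType) (k : field_kind).
Local Notation K := (base_field R k).

Lemma conj_baseB : zmod_morphism (@conj_base R k).
Proof. by case: k => //= x y; rewrite rmorphB. Qed.

Lemma conj_baseM : monoid_morphism (@conj_base R k).
Proof. by case: k => //=; split=> [|x y]; rewrite ?rmorph1 ?rmorphM. Qed.

HB.instance Definition _ :=
  GRing.isZmodMorphism.Build K K (@conj_base R k) conj_baseB.
HB.instance Definition _ :=
  GRing.isMonoidMorphism.Build K K (@conj_base R k) conj_baseM.

Lemma conj_baseK : involutive (@conj_base R k).
Proof. by case: k => //= x; rewrite conjCK. Qed.

Lemma mul_conj_base_ge0 (x : K) : 0 <= x * conj_base x.
Proof.
by case: k x => /= x; [rewrite -expr2 sqr_ge0 | rewrite mul_conjC_ge0].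
Qed.

Lemma mul_conj_base_eq0 (x : K) : (x * conj_base x == 0) = (x == 0).
Proof.
by case: k x => /= x; [rewrite mulf_eq0 orbb | rewrite mul_conjC_eq0].
Qed.

Lemma conj_trK m n (A : 'M[K]_(m, n)) : conj_tr (conj_tr A) = A.
Proof. by apply/matrixP=> i j; rewrite !mxE conj_baseK. Qed.

Lemma conj_trM m n p (A : 'M[K]_(m, n)) (B : 'M[K]_(n, p)) :
  conj_tr (A *m B) = conj_tr B *m conj_tr A.
Proof. by rewrite /conj_tr trmx_mul map_mxM. Qed.

Lemma conj_tr_inv n (A : 'M[K]_n) : conj_tr (invmx A) = invmx (conj_tr A).
Proof. by rewrite /conj_tr trmx_inv map_invmx. Qed.

Lemma mulmx_conj_tr_eq0 m n (A : 'M[K]_(m, n)) :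
  A *m conj_tr A = 0 -> A = 0.
Proof.
move=> A0; apply/matrixP=> i j; rewrite mxE; apply/eqP.
have /eqP := congr1 (fun M : 'M_m => M i i) A0; rewrite !mxE.
rewrite psumr_eq0 => [/allP/(_ j (mem_index_enum _))/=|l _].
  by rewrite !mxE mul_conj_base_eq0.
by rewrite !mxE mul_conj_base_ge0.
Qed.

Lemma gram_unit m n (A : 'M[K]_(m, n)) :
  row_free A -> A *m conj_tr A \in unitmx.
Proof.
move=> fA; rewrite -row_free_unit; apply/inj_row_free => v vA0.
apply/(row_free_inj fA); rewrite mul0mx; apply: mulmx_conj_tr_eq0.
by rewrite conj_trM mulmxA -(mulmxA v) vA0 mul0mx.
Qed.

Lemma penrose_exists m n (X : 'M[K]_(m, n)) : exists Y, penrose X Y.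
Proof.
have : exists r (C : 'M_(m, r)) (B : 'M_(r, n)),
    [/\ X = C *m B, row_full C & row_free B].
  exists (\rank X), (col_base X), (row_base X).
  by rewrite mulmx_base col_base_full row_base_free.
case=> r [C [B [defX fullC freeB]]].
have uB : B *m conj_tr B \in unitmx by rewrite gram_unit.
have uC : conj_tr C *m C \in unitmx.
  by rewrite -{2}[C]conj_trK gram_unit // /row_free mxrank_map mxrank_tr.
pose Gb := B *m conj_tr B; pose Gc := conj_tr C *m C.
have GbE : conj_tr (invmx Gb) = invmx Gb.
  by rewrite conj_tr_inv conj_trM conj_trK.
have GcE : conj_tr (invmx Gc) = invmx Gc.
  by rewrite conj_tr_inv conj_trM conj_trK.
pose Y := conj_tr B *m invmx Gb *m (invmx Gc *m conj_tr C).
have XY : X *m Y = C *m (invmx Gc *m conj_tr C).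
  by rewrite {1}defX /Y !mulmxA -(mulmxA C B) -/Gb mulmxK.
have YX : Y *m X = conj_tr B *m invmx Gb *m B.
  by rewrite {1}defX /Y -!mulmxA (mulmxA (conj_tr C)) -/Gc mulKmx.
exists Y; apply/and4P; split; apply/eqP.
- by rewrite -mulmxA YX {1}defX !mulmxA -(mulmxA C) -/Gb mulmxK.
- by rewrite YX /Y !mulmxA -(mulmxA _ B) -/Gb mulmxKV.
- by rewrite XY !conj_trM GcE conj_trK !mulmxA.
- by rewrite YX !conj_trM GbE conj_trK !mulmxA.
Qed.

Definition mpinv m n (X : 'M[K]_(m, n)) : 'M[K]_(n, m) :=
  xchoose (penrose_exists X).

Lemma mpinvP m n (X : 'M[K]_(m, n)) : penrose X (mpinv X).
Proof. exact: xchooseP. Qed.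

Lemma penrose_uniq m n (X : 'M[K]_(m, n)) Y Z :
  penrose X Y -> penrose X Z -> Y = Z.
Proof.
case/and4P=> /eqP XYX /eqP YXY /eqP XYs /eqP YXs.
case/and4P=> /eqP XZX /eqP ZXZ /eqP XZs /eqP ZXs.
have XYZ : X *m Y = X *m Z.
  have XZXY : X *m Y = X *m Z *m (X *m Y) by rewrite mulmxA XZX.
  by rewrite -[LHS]XYs [in LHS]XZXY conj_trM XYs XZs mulmxA XYX.
have YXZ : Y *m X = Z *m X.
  have YXZX : Y *m X = Y *m X *m (Z *m X) by rewrite -mulmxA (mulmxA X) XZX.
  by rewrite -[LHS]YXs [in LHS]YXZX conj_trM YXs ZXs -mulmxA (mulmxA X) XYX.
by rewrite -YXY -mulmxA XYZ mulmxA YXZ ZXZ.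
Qed.

End MoorePenrose.

Definition colspace (R : realType) (k : field_kind) (n p : nat)
    (X : 'M[base_field R k]_(n, p)) : {vspace 'cV[base_field R k]_n} :=
  limg (linfun (mulmx X)).

Definition invariant_subspace (R : realType) (k : field_kind) (n : nat)
    (A : 'M[base_field R k]_n) (U : {vspace 'cV[base_field R k]_n}) : Prop :=
  (linfun (mulmx A) @: U <= U)%VS.

Definition star_adj (R : realType) (k : field_kind) (s : star_kind) (n : nat)
    (H A : 'M[base_field R k]_n) : 'M[base_field R k]_n :=
  invmx H *m star s A *m H.

Inductive algebra_kind := Lie | Jordan.

Definition in_algebra (R : realType) (k : field_kind) (s : star_kind)
    (a : algebra_kind) (n : nat) (H A : 'M[base_field R k]_n) : Prop :=
  match a with
  | Lie => star_adj s H A = - A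
  | Jordan => star_adj s H A = A
  end.

Definition eps2 (R : realType) (k : field_kind) (a : algebra_kind) :
    base_field R k :=
  match a with
  | Lie => -1
  | Jordan => 1
  end.

(* Main.v *)
(** Multiplying by [H] turns membership of [DA] in the Lie or Jordan algebra into
    the symmetry [star (H DA) = e (H DA)] with [e = eps1 * eps2].  With
    [X = Xc Q], the equation [(A + DA) X = X La] becomes [M X = C] for the
    unknown [M = H DA] and [C = H Xc (Q La - Lc Q)].  This has an
    [e]-symmetric solution iff [star X C] is [e]-symmetric, which is what the
    compatibility condition says because [H A] is already [e]-symmetric; since
    the pseudoinverse is a left inverse of [X], splitting [1 = X P + (1 - X P)]
    on both sides of [M] parametrizes the solutions. *)
Require Import Defs.
From mathcomp Require Import all_boot all_order all_algebra.
From mathcomp Require Import complex.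
From mathcomp Require Import reals.
Set Implicit Arguments.
Unset Strict Implicit.
Unset Printing Implicit Defensive.
Import Order.TTheory GRing.Theory Num.Theory.
Local Open Scope ring_scope.

Section Star.
Variables (R : realType) (k : field_kind) (s : star_kind).
Local Notation K := (base_field R k).

Lemma starM m n p (A : 'M[K]_(m, n)) (B : 'M[K]_(n, p)) :
  star s (A *m B) = star s B *m star s A.
Proof. by case: s; [exact: trmx_mul | exact: conj_trM]. Qed.

Lemma starK m n (A : 'M[K]_(m, n)) : star s (star s A) = A.
Proof. by case: s; [exact: trmxK | exact: conj_trK]. Qed.

Lemma starB m n (A B : 'M[K]_(m, n)) : star s (A - B) = star s A - star s B.
Proof. by case: s; rewrite /= /conj_tr linearB //= map_mxB. Qed.

Lemma starN m n (A : 'M[K]_(m, n)) : star s (- A) = - star s A.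
Proof. by case: s; rewrite /= /conj_tr linearN //= map_mxN. Qed.

Lemma starD m n (A B : 'M[K]_(m, n)) : star s (A + B) = star s A + star s B.
Proof. by case: s; rewrite /= /conj_tr linearD //= map_mxD. Qed.

Lemma star0 m n : star s (0 : 'M[K]_(m, n)) = 0.
Proof. by rewrite -(subrr 0) starB subrr. Qed.

(** A scalar of square 1 is 1 or -1, hence fixed by conjugation, so it passes through the
    conjugate-linear star as well as through the transpose. *)
Lemma starZ_sign (e : K) m n (A : 'M[K]_(m, n)) :
  e ^+ 2 = 1 -> star s (e *: A) = e *: star s A.
Proof.
move=> /eqP; rewrite sqrf_eq1 => /orP[]/eqP->.
  by rewrite !scale1r.
by rewrite !scaleN1r starN.
Qed.

Lemma signZK (e : K) m n (A : 'M[K]_(m, n)) :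
  e ^+ 2 = 1 -> e *: (e *: A) = A.
Proof. by rewrite scalerA -expr2 => ->; rewrite scale1r. Qed.

Lemma eps2_sqr a : eps2 R k a ^+ 2 = 1.
Proof. by case: a; rewrite ?sqrrN expr1n. Qed.

Lemma in_algebraE a n (H A : 'M[K]_n) (e : K) :
    H \in unitmx -> e ^+ 2 = 1 -> star s H = e *: H ->
  in_algebra s a H A <-> star s (H *m A) = (e * eps2 R k a) *: (H *m A).
Proof.
move=> uH e1 sH; rewrite starM sH -scalemxAr -scalerA.
have -> : in_algebra s a H A <-> star_adj s H A = eps2 R k a *: A.
  by case: a; rewrite /= ?scaleN1r ?scale1r.
rewrite /star_adj; split=> [adjA|/(congr1 ( *:%R e))].
  by congr (_ *: _); rewrite scalemxAr -adjA !mulmxA mulmxV // mul1mx.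
by rewrite !signZK // -mulmxA => ->; rewrite -scalemxAr mulKmx.
Qed.

Lemma star_congr_sign (e : K) n p (M : 'M[K]_n) (X : 'M[K]_(n, p)) :
    star s M = e *: M ->
  star s (star s X *m M *m X) = e *: (star s X *m M *m X).
Proof.
by move=> sM; rewrite !starM starK sM -scalemxAl -scalemxAr mulmxA.
Qed.

Lemma sign_sym_solutions (e : K) n p (X C : 'M[K]_(n, p)) (P : 'M[K]_(p, n))
    (M : 'M[K]_n) :
    e ^+ 2 = 1 -> P *m X = 1%:M ->
    star s (star s X *m C) = e *: (star s X *m C) ->
  (star s M = e *: M /\ M *m X = C) <->
  exists2 Z : 'M[K]_n, star s Z = e *: Z &
    M = C *m P
        + e *: (star s (C *m P) - star s P *m star s (star s X *m C) *m P)
        + star s (1%:M - X *m P) *m Z *m (1%:M - X *m P).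
Proof.
move=> e1 PX sXC; have sXCE : star s (star s X *m C) = star s C *m X.
  by rewrite starM starK.
split=> [[sM MX]|[Z sZ ->]].
  (* [M] itself serves as [Z]: compressing it by [1 - X P] on both sides removes exactly the parts
     fixed by [M X = C] and its star, [star X M = e star C]. *)
  exists M => //.
  have XM : star s X *m M = e *: star s C.
    by rewrite -MX starM sM -scalemxAr signZK.
  have star1 : star s (1%:M : 'M[K]_n) = 1%:M.
    by case: s; rewrite /= /conj_tr trmx1 ?map_mx1.
  have -> : star s (1%:M - X *m P) *m M = M - e *: star s (C *m P).
    by rewrite starB star1 !starM mulmxBl mul1mx -mulmxA XM scalemxAr.
  rewrite mulmxBr mulmx1 mulmxA mulmxBl MX mulmxBl -!scalemxAl.
  rewrite sXCE !mulmxA -starM scalerBr.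
  set t := C *m P; set u := e *: _; set q := e *: _.
  by rewrite -[M - u - _]addrA -opprD (addrCA u t) [RHS]addrC subrK.
(* Multiplied by [X] on the right, the [Z] term dies since [P X = 1], and both terms of the bracket
   become [star P star C X]; only [C] remains. *)
split; last first.
  have KX : (1%:M - X *m P) *m X = 0.
    by rewrite mulmxBl mul1mx -mulmxA PX mulmx1 subrr.
  rewrite !mulmxDl -scalemxAl -(mulmxA _ (_ - _)) KX mulmx0 addr0 mulmxBl sXCE.
  by rewrite -!mulmxA PX !mulmx1 mulmxA -starM subrr scaler0 addr0.
rewrite [LHS]starD [RHS]scalerDr; congr (_ + _); last first.
  by rewrite !starM starK sZ -scalemxAl -scalemxAr mulmxA.
(* The star exchanges [C P] and [e star (C P)] up to the factor [e]; what remains is the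
   [e]-symmetry of the correction term, inherited from [star X C]. *)
rewrite starD starZ_sign // scalerDr signZK // starB starK scalerBr addrCA.
congr (_ + (_ - _)); rewrite 2!starM starK sXC.
by rewrite -scalemxAr -scalemxAl starK mulmxA.
Qed.

End Star.

Section ColumnSpace.
Variables (R : realType) (k : field_kind).
Local Notation K := (base_field R k).

(** Full column rank gives some left inverse [B], which cancels the leading [X] in the Penrose
    identity [X P X = X]. *)
Lemma mpinv_mulmx n p (X : 'M[K]_(n, p)) :
  \rank X = p -> mpinv X *m X = 1%:M.
Proof.
move=> rX; have /row_fullP[B BX] : row_full X by rewrite /row_full rX.
have /and4P[/eqP XPX _ _ _] := mpinvP X.
by rewrite -[LHS]mul1mx -BX -!mulmxA (mulmxA X) XPX.
Qed.

Lemma mem_colspace n p (X : 'M[K]_(n, p)) (v : 'cV[K]_n) :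
  reflect (exists u, v = X *m u) (v \in colspace X).
Proof.
by apply: (iffP memv_imgP) => [[u _ ->]|[u ->]]; exists u;
  rewrite ?lfunE ?memvf.
Qed.

Lemma invariant_colspace n p (A : 'M[K]_n) (X : 'M[K]_(n, p)) :
  invariant_subspace A (colspace X) <-> exists L, A *m X = X *m L.
Proof.
split=> [invA|[L AX]]; last first.
  apply/subvP=> _ /memv_imgP[_ /mem_colspace[u ->] ->]; rewrite lfunE /=.
  by apply/mem_colspace; exists (L *m u); rewrite !mulmxA AX.
(* The image of each column of [X] is again a combination [X u_j] of columns; the [u_j] become the
   columns of [L]. *)
have /fin_all_exists[u AXu] j : exists u, A *m col j X = X *m u.
  apply/mem_colspace; have /subvP := invA; apply; apply/memv_imgP.
  exists (col j X); last by rewrite lfunE.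
  by apply/mem_colspace; exists (delta_mx j 0); rewrite colE.
exists (\matrix_(i, j) u j i 0); apply/matrixP=> i j.
have := congr1 (fun v : 'cV_n => v i 0) (AXu j); rewrite !mxE.
under eq_bigr do rewrite mxE.
by move=> ->; apply: eq_bigr => l _; rewrite mxE.
Qed.

End ColumnSpace.

Theorem theorem2p6 (R : realType) (k : field_kind) (s : star_kind)
    (a : algebra_kind) (n p : nat)
    (H : 'M[base_field R k]_n) (eps1 : base_field R k)
    (H_unitary : unitary_matrix H)
    (eps1_sign : eps1 = 1 \/ eps1 = -1)
    (H_star : star s H = eps1 *: H)
    (A : 'M[base_field R k]_n) (A_S : in_algebra s a H A)
    (p_le_n : (p <= n)%N)
    (U : {vspace 'cV[base_field R k]_n})
    (U_inv : invariant_subspace A U)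
    (U_dim : \dim U = p)
    (Xc : 'M[base_field R k]_(n, p)) (Lc : 'M[base_field R k]_p)
    (Xc_full : \rank Xc = p)
    (Xc_U : colspace Xc = U)
    (AXc : A *m Xc = Xc *m Lc) :
  let e2 := eps2 R k a in
  let compatible (Q La : 'M[base_field R k]_p) :=
    star s Q *m (star s Xc *m H *m Xc) *m Q *m La =
    e2 *: (star s La *m star s Q *m (star s Xc *m H *m Xc) *m Q) in
  ((exists DA : 'M[base_field R k]_n,
      in_algebra s a H DA /\ invariant_subspace (A + DA) U)
   <->
   (exists La : 'M[base_field R k]_p,
      exists2 Q : 'M[base_field R k]_p, Q \in unitmx & compatible Q La))
  /\
  (forall La Q : 'M[base_field R k]_p, Q \in unitmx -> compatible Q La ->
   forall DA : 'M[base_field R k]_n,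
     (in_algebra s a H DA /\ (A + DA) *m (Xc *m Q) = (Xc *m Q) *m La)
     <->
     (exists2 Z : 'M[base_field R k]_n, star s Z = (eps1 * e2) *: Z &
        let Qt := Q *m La - Lc *m Q in
        let P := mpinv (Xc *m Q) in
        DA = Xc *m Qt *m P
           + (eps1 * e2) *: (invmx H *m
               (star s (H *m Xc *m Qt *m P)
                - star s P *m star s (star s Q *m star s Xc *m H *m Xc *m Qt)
                  *m P))
           + invmx H *m star s (1%:M - (Xc *m Q) *m P) *m Z
             *m (1%:M - (Xc *m Q) *m P))).
Proof.
move=> e2 compatible.
have uH : H \in unitmx by case/mulmx1_unit: H_unitary.
have e1 : eps1 ^+ 2 = 1 by case: eps1_sign => ->; rewrite ?sqrrN expr1n.
have e12 : (eps1 * e2) ^+ 2 = 1 by rewrite exprMn e1 eps2_sqr mulr1.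
have algE D := in_algebraE a D uH e1 H_star.
have sHA := (algE A).1 A_S.
(* With [X = Xc Q], the matrix [star X H X] is [eps1]-symmetric, which turns compatibility into
   [eps1 * e2]-symmetry of [star X H X La]. *)
have compatE Q La : compatible Q La <->
    star s (star s (Xc *m Q) *m H *m (Xc *m Q) *m La)
    = (eps1 * e2) *: (star s (Xc *m Q) *m H *m (Xc *m Q) *m La).
  have -> : star s (star s (Xc *m Q) *m H *m (Xc *m Q) *m La)
      = eps1 *: (star s La *m star s Q *m (star s Xc *m H *m Xc) *m Q).
    by rewrite starM (star_congr_sign _ H_star) -scalemxAr starM !mulmxA.
  rewrite /compatible starM !mulmxA -scalerA; split=> [->|].
    by rewrite signZK ?eps2_sqr.
  move=> /(congr1 ( *:%R eps1)) /(congr1 ( *:%R e2)).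
  by rewrite !signZK ?eps2_sqr // => ->.
(* The parametrization comes first, since the equivalence takes its [DA] from it. *)
refine ((fun part2 part1 => conj (part1 part2) part2) _ _).
  move=> La Q uQ /compatE sLa DA.
  set Qt := _ - Lc *m Q; set P := mpinv _; cbv zeta.
  have PX : P *m (Xc *m Q) = 1%:M.
    by apply: mpinv_mulmx; rewrite mxrankMfree ?row_free_unit.
  have XcQt : Xc *m Qt = Xc *m Q *m La - A *m (Xc *m Q).
    by rewrite mulmxBr !mulmxA AXc.
  have sXC : star s (star s (Xc *m Q) *m (H *m Xc *m Qt))
      = (eps1 * e2) *: (star s (Xc *m Q) *m (H *m Xc *m Qt)).
    (* Here [star X C = star X H X La - star X H A X]: compatibility handles the first term, the
       symmetry of [H A] the second. *)
    rewrite -(mulmxA H) XcQt 2!mulmxBr starB scalerBr; congr (_ - _).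
      by move: sLa; rewrite !mulmxA.
    by have := star_congr_sign (Xc *m Q) sHA; rewrite !mulmxA.
  have eqE : (A + DA) *m (Xc *m Q) = Xc *m Q *m La
      <-> H *m DA *m (Xc *m Q) = H *m Xc *m Qt.
    rewrite -!(mulmxA H) XcQt mulmxDl; split=> [<-|/(can_inj (mulKmx uH)) ->].
      by rewrite addrC addKr.
    by rewrite addrC subrK.
  have -> : (in_algebra s a H DA /\ (A + DA) *m (Xc *m Q) = Xc *m Q *m La) <->
      (star s (H *m DA) = (eps1 * e2) *: (H *m DA) /\
       H *m DA *m (Xc *m Q) = H *m Xc *m Qt) by rewrite algE eqE.
  rewrite (sign_sym_solutions _ e12 PX sXC).
  clearbody Qt P; rewrite (starM s Xc Q) !mulmxA.
  split=> -[Z sZ DAE]; exists Z => //.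
    rewrite -[DA](mulKmx uH) DAE 2!mulmxDr -scalemxAr !mulmxA mulVmx //.
    by rewrite mul1mx.
  by rewrite DAE 2!mulmxDr -scalemxAr !mulmxA mulmxV // !mul1mx.
move=> part2; rewrite -Xc_U; split=> [[DA [DA_S /invariant_colspace[La DAX]]]|].
  (* With [Q = 1], the matrix to be symmetric is [star Xc H (A + DA) Xc], a congruence of the
     symmetric [H (A + DA)]. *)
  exists La, 1%:M; rewrite ?unitmx1 //; apply/compatE.
  have sHAD : star s (H *m (A + DA)) = (eps1 * e2) *: (H *m (A + DA)).
    by rewrite mulmxDr starD sHA ((algE DA).1 DA_S) scalerDr.
  rewrite mulmx1 -[_ *m La]mulmxA -DAX mulmxA -(mulmxA _ H).
  exact: star_congr_sign sHAD.
case=> La [Q uQ cQ].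
(* The parameter [Z = 0] already yields a suitable [DA]. *)
have s0 : star s (0 : 'M_n) = (eps1 * e2) *: 0 by rewrite star0 scaler0.
have [DA_S DAX] := (part2 La Q uQ cQ _).2 (ex_intro2 _ _ 0 s0 erefl).
eexists; split; first exact: DA_S.
(* Undoing the change of basis [Q] gives the matrix of [A + DA] with respect to [Xc]. *)
apply/invariant_colspace; exists (Q *m La *m invmx Q).
by rewrite !mulmxA -(mulmxA Xc Q La) mulmxA -DAX !mulmxA mulmxK.
Qed.
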